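(* Let $(A,\mu,\alpha,\beta)$ be a regular BiHom-alternative algebra, and write $xy=\mu(x,y)$. Then the following BiHom-Moufang identities hold for all $x,y,z\in A$: (i) $\Big(\beta^3(x)\big(\beta^2(y)\,\alpha\beta(x)\big)\Big)\alpha^2\beta^2(z)=\alpha\beta^3(x)\Big(\alpha\beta^2(y)\big(\alpha\beta(x)\,\alpha^2(z)\big)\Big)$; (ii) $\Big(\big(\beta^2(z)\,\alpha\beta(x)\big)\alpha^2\beta(y)\Big)\alpha^3\beta(x)=\alpha^2\beta^2(z)\Big(\big(\alpha\beta(x)\,\alpha^2(y)\big)\alpha^3(x)\Big)$; (iii) $\Big(\alpha\beta^2(x)\,\alpha^2\beta(y)\Big)\Big(\alpha^2\beta(z)\,\alpha^3(x)\Big)=\Big(\alpha\beta^2(x)\big(\alpha\beta(y)\,\alpha^2(z)\big)\Big)\alpha^3\beta(x)$.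
   Context: All vector spaces are over an algebraically closed field $\mathbb{K}$ of characteristic $0$. For a quadruple $(A,\mu,\alpha,\beta)$ with $\mu:A\otimes A\to A$, $\alpha,\beta:A\to A$ linear, the BiHom-associator is $as_{\alpha,\beta}(x,y,z)=\mu(\mu(x,y),\beta(z))-\mu(\alpha(x),\mu(y,z))$. A BiHom-alternative algebra is such a quadruple with $\alpha\beta=\beta\alpha$, $\alpha\mu=\mu\alpha^{\otimes 2}$, $\beta\mu=\mu\beta^{\otimes 2}$ and, for all $x,y,z\in A$, $as_{\alpha,\beta}(\beta(x),\alpha(y),z)+as_{\alpha,\beta}(\beta(y),\alpha(x),z)=0$ and $as_{\alpha,\beta}(x,\beta(y),\alpha(z))+as_{\alpha,\beta}(x,\beta(z),\alpha(y))=0$. It is regular if $\alpha$ and $\beta$ are algebra automorphisms. Expressions such as $\alpha^i\beta^j(x)$ denote the composite map $\alpha^i\beta^j$ applied to $x$. *)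

(* Defs.v *)
From mathcomp Require Import all_boot all_order all_algebra.
From mathcomp Require Import sesquilinear.

Set Implicit Arguments.
Unset Strict Implicit.
Unset Printing Implicit Defensive.

Import GRing.Theory.
Local Open Scope ring_scope.

Definition bihom_as (V : zmodType) (mu : V -> V -> V) (alpha beta : V -> V)
    (x y z : V) : V :=
  mu (mu x y) (beta z) - mu (alpha x) (mu y z).

(* A linear map A (x) A -> A is given as a bilinear map A -> A -> A. *)
Record bihom_alternative (K : fieldType) (A : lmodType K)
    (mu : {bilinear A -> A -> A}) (alpha beta : {linear A -> A}) : Prop :=
  BihomAlternative {
    bihom_comm : forall x, alpha (beta x) = beta (alpha x);
    bihom_morphl : {morph alpha : x y / mu x y};
    bihom_morphr : {morph beta : x y / mu x y};
    bihom_left_alt : forall x y z,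
      bihom_as mu alpha beta (beta x) (alpha y) z
        + bihom_as mu alpha beta (beta y) (alpha x) z = 0;
    bihom_right_alt : forall x y z,
      bihom_as mu alpha beta x (beta y) (alpha z)
        + bihom_as mu alpha beta x (beta z) (alpha y) = 0
  }.

Definition algebra_automorphism (K : fieldType) (A : lmodType K)
    (mu : {bilinear A -> A -> A}) (f : {linear A -> A}) : Prop :=
  {morph f : x y / mu x y} /\ bijective f.

Record regular_bihom_alternative (K : fieldType) (A : lmodType K)
    (mu : {bilinear A -> A -> A}) (alpha beta : {linear A -> A}) : Prop :=
  RegularBihomAlternative {
    regular_bihom : bihom_alternative mu alpha beta;
    regular_autl : algebra_automorphism mu alpha;
    regular_autr : algebra_automorphism mu beta
  }.

(* The composite map alpha^i beta^j. *)
Definition bihom_pow (T : Type) (alpha beta : T -> T) (i j : nat) : T -> T :=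
  iter i alpha \o iter j beta.

(* Main.v *)
(**
  A regular BiHom-alternative product is a Yau twist: [m x y = mu (alpha^-1 x) (beta^-1 y)] is
  an alternative product for which [alpha] and [beta] are automorphisms, and
  [mu x y = m (alpha x) (beta y)].  Expanding both sides of each identity in terms of [m], every
  occurrence of a variable acquires the same power [alpha^i beta^j], so the identities are the
  classical Moufang identities of [m] at the points [alpha^i beta^j x], etc.
*)
Require Import Defs.
From mathcomp Require Import all_boot all_order all_algebra.
From mathcomp Require Import sesquilinear.

Set Implicit Arguments.
Unset Strict Implicit.
Unset Printing Implicit Defensive.

Import GRing.Theory.

Record alternative_mul (V : zmodType) (m : V -> V -> V) : Prop :=
  AlternativeMul {
    alt_mulDl : forall x y z, (m (x + y) z = m x z + m y z)%R;
    alt_mulDr : forall x y z, (m x (y + z) = m x y + m x z)%R;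
    alt_mull : forall x y, m (m x x) y = m x (m x y);
    alt_mulr : forall x y, m (m y x) x = m y (m x x)
  }.

(** Reversing the product swaps the two alternative laws, so every left-handed identity yields its
    right-handed mirror image. *)
Lemma alternative_mul_opp (V : zmodType) (m : V -> V -> V) :
  alternative_mul m -> alternative_mul (fun x y => m y x).
Proof. by case=> Dl Dr altl altr; split=> *; rewrite ?Dl ?Dr ?altl ?altr. Qed.

(** Polarization: expand left alternativity at [x + y] and cancel the two pure-square terms. *)
Lemma alt_mull_lin (V : zmodType) (m : V -> V -> V) (x y z : V) :
  alternative_mul m ->
  (m (m x y) z + m (m y x) z = m x (m y z) + m y (m x z))%R.
Proof.
case=> Dl Dr altl _; have := altl (x + y)%R z.
rewrite !(Dl, Dr) !altl -!addrA => /addrI; rewrite !addrA => /addIr.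
by rewrite addrC => <-; rewrite addrC.
Qed.

Lemma alt_mulr_lin (V : zmodType) (m : V -> V -> V) (x y z : V) :
  alternative_mul m ->
  (m (m x y) z + m (m x z) y = m x (m y z) + m x (m z y))%R.
Proof.
by move/alternative_mul_opp/alt_mull_lin=> /(_ z y x) <-; rewrite addrC.
Qed.

Lemma alt_flexible (V : zmodType) (m : V -> V -> V) (x y : V) :
  alternative_mul m -> m (m x y) x = m x (m y x).
Proof.
move=> altm; have := alt_mulr_lin x y x altm.
by rewrite (alt_mull altm) => /addIr.
Qed.

Lemma moufang_left (V : zmodType) (m : V -> V -> V) (x y z : V) :
  alternative_mul m -> m (m x (m y x)) z = m x (m y (m x z)).
Proof.
move=> altm; have Dr := alt_mulDr altm.
have E1 := alt_mull_lin (m x y) x z altm.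
have E2 := alt_mulr_lin x y (m x z) altm.
(* Multiplying twice by [x] on the left is multiplying by [m x x], so this is linearized right
   alternativity at [m x x], [y], [z]. *)
have E3 : (m (m x (m x y)) z + m (m x (m x z)) y
           = m x (m (m x y) z) + m x (m (m x z) y))%R.
  rewrite -Dr (alt_mulr_lin x y z altm) Dr -!(alt_mull altm).
  exact: alt_mulr_lin.
rewrite -(alt_flexible _ _ altm).
apply: (@addIr _ (m (m x (m x y)) z + m (m x (m x z)) y)%R).
by rewrite addrA E1 E3 addrAC E2 -addrA [X in (_ + X)%R]addrC.
Qed.

Lemma moufang_right (V : zmodType) (m : V -> V -> V) (x y z : V) :
  alternative_mul m -> m (m (m z x) y) x = m z (m (m x y) x).
Proof. by move/alternative_mul_opp/moufang_left=> /(_ x y z). Qed.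

Lemma moufang_middle (V : zmodType) (m : V -> V -> V) (x y z : V) :
  alternative_mul m -> m (m x y) (m z x) = m (m x (m y z)) x.
Proof.
move=> altm; rewrite (alt_flexible _ _ altm).
(* Cyclic invariance of the associator: [(y,z,x) = (z,x,y)]. *)
have E : (m y (m z x) + m (m z x) y = m (m y z) x + m z (m x y))%R.
  have E1 := alt_mull_lin y z x altm; have E2 := alt_mulr_lin z x y altm.
  apply: (@addIr _ (m (m z y) x)); rewrite -addrA E2 addrAC E1.
  by rewrite addrA addrAC.
(* By [moufang_left] the added term equals [m x (m z (m x y))], so both sides are [x] times a side
   of [E]. *)
apply: (@addIr _ (m (m x (m z x)) y)); rewrite (alt_mulr_lin _ _ _ altm).
by rewrite (moufang_left _ _ _ altm) -!(alt_mulDr altm) E.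
Qed.

(** Each BiHom-alternative law at equal arguments says only that twice an associator vanishes. *)
Lemma pchar0_double_eq0 (K : fieldType) (A : lmodType K) (v : A) :
  [pchar K]%R =i pred0 -> (v + v = 0)%R -> v = 0%R.
Proof.
move=> /pcharf0P charK0 /eqP.
by rewrite -mulr2n -scaler_nat scaler_eq0 charK0 => /eqP.
Qed.

Lemma bihom_untwist (K : fieldType) (charK0 : [pchar K]%R =i pred0)
    (A : lmodType K) (mu : {bilinear A -> A -> A}%R)
    (alpha beta : {linear A -> A}%R) :
  regular_bihom_alternative mu alpha beta ->
  exists m : A -> A -> A,
    [/\ alternative_mul m, {morph alpha : x y / m x y},
        {morph beta : x y / m x y} & forall x y, mu x y = m (alpha x) (beta y)].
Proof.
case=> -[comm _ _ altl altr] [morphl [a' aK a'K]] [morphr [b' bK b'K]].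
pose m x y := mu (a' x) (b' y).
have comm_a'b x : a' (beta x) = beta (a' x).
  by apply: (can_inj aK); rewrite a'K comm a'K.
have comm_b'a x : b' (alpha x) = alpha (b' x).
  by apply: (can_inj bK); rewrite b'K -comm b'K.
have ma : {morph alpha : x y / m x y}.
  by move=> x y; rewrite /m morphl comm_b'a a'K aK.
have mb : {morph beta : x y / m x y}.
  by move=> x y; rewrite /m morphr comm_a'b b'K bK.
have muE x y : mu x y = m (alpha x) (beta y) by rewrite /m aK bK.
exists m; split=> //.
have a'D x y : (a' (x + y) = a' x + a' y)%R.
  by apply: (can_inj aK); rewrite linearD !a'K.
have b'D x y : (b' (x + y) = b' x + b' y)%R.
  by apply: (can_inj bK); rewrite linearD !b'K.
split=> [x y z|x y z|x y|x y].
- by rewrite /m a'D linearDl.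
- by rewrite /m b'D linearDr.
(* In terms of [m], the law at [u], [u], [v] concerns the points [alpha^2 beta u] and [beta^2 v];
   the witnesses make these [x] and [y]. *)
- have /(pchar0_double_eq0 charK0) := altl (b' (a' (a' x))) (b' (a' (a' x))) (b' (b' y)).
  rewrite /bihom_as !muE !(ma, mb) -!comm !b'K !a'K => /eqP.
  by rewrite subr_eq0 => /eqP.
(* Here the points are [alpha^2 v] and [alpha beta^2 u]. *)
- have /(pchar0_double_eq0 charK0) := altr (a' (a' y)) (a' (b' (b' x))) (a' (b' (b' x))).
  rewrite /bihom_as !muE !(ma, mb) !comm !a'K !b'K => /eqP.
  by rewrite subr_eq0 => /eqP.
Qed.

Theorem theorem3p1 (K : closedFieldType) (charK0 : [pchar K]%R =i pred0)
    (A : lmodType K) (mu : {bilinear A -> A -> A}%R)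
    (alpha beta : {linear A -> A}%R)
    (hA : regular_bihom_alternative mu alpha beta) (x y z : A) :
  let p := bihom_pow alpha beta in
  [/\ mu (mu (p 0 3 x) (mu (p 0 2 y) (p 1 1 x))) (p 2 2 z)
        = mu (p 1 3 x) (mu (p 1 2 y) (mu (p 1 1 x) (p 2 0 z))),
      mu (mu (mu (p 0 2 z) (p 1 1 x)) (p 2 1 y)) (p 3 1 x)
        = mu (p 2 2 z) (mu (mu (p 1 1 x) (p 2 0 y)) (p 3 0 x))
    & mu (mu (p 1 2 x) (p 2 1 y)) (mu (p 2 1 z) (p 3 0 x))
        = mu (mu (p 1 2 x) (mu (p 1 1 y) (p 2 0 z))) (p 3 1 x)].
Proof.
have [m [altm ma mb muE]] := bihom_untwist charK0 hA.
have comm := bihom_comm (regular_bihom hA).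
(* The common power is [alpha^2 beta^3] in the first identity and [alpha^3 beta^2] in the other two;
   [comm] moves each [beta] outward, making equal powers syntactically equal. *)
rewrite /bihom_pow /= !muE !(ma, mb) !comm; split.
- exact: moufang_left.
- exact: moufang_right.
- exact: moufang_middle.
Qed.
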